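(* Let $(X_1,\|\cdot\|_1)$ and $(X_2,\|\cdot\|_2)$ be two order continuous Banach lattices which are both order dense ideals in a vector lattice $Y$. Then $X_1$ and $X_2$ induce the same un-topology on $Y$.
   Context: All vector lattices are Archimedean. An ideal $X$ of a vector lattice $Y$ is a linear subspace such that $|y|\le|x|$, $x\in X$, $y\in Y$ imply $y\in X$; a sublattice $X$ is order dense in $Y$ if for every non-zero $y\in Y_+$ there is $x\in X$ with $0<x\le y$. A normed lattice $X$ is order continuous if $x_\alpha\downarrow 0$ in $X$ implies $\|x_\alpha\|\to 0$. If a normed lattice $X$ is an ideal in $Y$, a net $(y_\alpha)$ in $Y$ un-converges to $y\in Y$ with respect to $X$ if $\bigl\||y_\alpha-y|\wedge x\bigr\|_X\to 0$ for every $x\in X_+$. The un-topology on $Y$ induced by $X$ is the topology in which $W\subseteq Y$ is a neighbourhood of $y$ iff $y+U_{\varepsilon,x}\subseteq W$ for some $\varepsilon>0$ and $x\in X_+$, where $U_{\varepsilon,x}=\{z\in Y: \||z|\wedge x\|_X<\varepsilon\}$; convergence in this topology is exactly un-convergence with respect to $X$. *)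

(* Defs.v *)
From HB Require Import structures.
From mathcomp Require Import all_boot all_order all_algebra.
From mathcomp Require Import all_classical all_reals all_analysis.

Set Implicit Arguments.
Unset Strict Implicit.
Unset Printing Implicit Defensive.

Import Order.TTheory GRing.Theory Num.Theory.
Import numFieldNormedType.Exports.

Local Open Scope classical_set_scope.
Local Open Scope ring_scope.

Reserved Notation "x <=v y" (at level 70, y at next level).
Reserved Notation "x <v y" (at level 70, y at next level).

(* The order is not taken from [Order.Lattice]: since [realDomainType] already
   inherits from both [Order.Lattice] and [GRing.Zmodule], Hierarchy Builder
   rejects any new structure joining these two. *)
HB.mixin Record Lmodule_isVectorLattice (R : realType) V of GRing.Lmodule R V := {
  vle : rel V ;
  vmeet : V -> V -> V ;
  vjoin : V -> V -> V ;
  vle_refl : reflexive vle ;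
  vle_anti : antisymmetric vle ;
  vle_trans : transitive vle ;
  vlexI : forall x y z : V, vle x (vmeet y z) = vle x y && vle x z ;
  vleUx : forall x y z : V, vle (vjoin x y) z = vle x z && vle y z ;
  vleD2r : forall x y z : V, vle x y -> vle (x + z) (y + z) ;
  vscale_ge0 : forall (a : R) (x : V), 0 <= a -> vle 0 x -> vle 0 (a *: x)
}.

#[short(type="vectorLatticeType")]
HB.structure Definition VectorLattice (R : realType) :=
  { V of GRing.Lmodule R V & Lmodule_isVectorLattice R V }.

Notation "x <=v y" := (vle x y) : ring_scope.
Notation "x <v y" := ((x != y) && (x <=v y)) : ring_scope.

Definition vabs (R : realType) (V : vectorLatticeType R) (x : V) : V :=
  vjoin x (- x).

Definition vl_archimedean (R : realType) (V : vectorLatticeType R) : Prop :=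
  forall x y : V, 0 <=v x -> (forall n : nat, x *+ n <=v y) -> x = 0.

HB.mixin Record NormedModule_VectorLattice_isNormedLattice (R : realType) X
    of NormedModule R X & VectorLattice R X := {
  ler_norm_vabs : forall x y : X, vabs x <=v vabs y -> `|x| <= `|y|
}.

#[short(type="normedLatticeType")]
HB.structure Definition NormedLattice (R : realType) :=
  { X of NormedModule R X & VectorLattice R X
       & NormedModule_VectorLattice_isNormedLattice R X }.

#[short(type="banachLatticeType")]
HB.structure Definition BanachLattice (R : realType) :=
  { X of NormedLattice R X & CompleteNormedModule R X }.

Definition directed_preorder (I : Type) (le : I -> I -> Prop) : Prop :=
  [/\ inhabited I, forall i, le i i,
      forall i j k, le i j -> le j k -> le i k
    & forall i j, exists k, le i k /\ le j k].

Definition net_tails (I : Type) (le : I -> I -> Prop) : set_system I :=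
  [set A | exists i, [set j | le i j] `<=` A].

Definition net_decreases_to0 (R : realType) (V : vectorLatticeType R)
    (I : Type) (le : I -> I -> Prop) (x : I -> V) : Prop :=
  [/\ forall i j, le i j -> x j <=v x i,
      forall i, 0 <=v x i
    & forall y, (forall i, y <=v x i) -> y <=v 0].

Definition order_continuous (R : realType) (X : normedLatticeType R) : Prop :=
  forall (I : Type) (le : I -> I -> Prop) (x : I -> X),
    directed_preorder le -> net_decreases_to0 le x ->
    `|x i| @[i --> net_tails le] --> (0 : R).

(* [X] is a vector lattice in its own right; being an ideal of [Y] is expressed
   by an inclusion map, which identifies [X] with an ideal of [Y] carrying the
   inherited linear structure and order. *)
Record ideal_inclusion (R : realType) (X Y : vectorLatticeType R) := {
  incl :> {linear X -> Y} ;
  incl_le : {mono incl : x y / x <=v y} ;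
  incl_ideal : forall (x : X) (y : Y),
    vabs y <=v vabs (incl x) -> exists u : X, incl u = y
}.

Definition order_dense (R : realType) (X Y : vectorLatticeType R)
    (j : ideal_inclusion X Y) : Prop :=
  forall y : Y, 0 <v y -> exists x : X, 0 <v j x /\ j x <=v y.

(* The element [u] is the one that the inclusion identifies with
   [|z| /\ x]; it exists for every [z] as soon as [0 <=v x] and is unique. *)
Definition un_ball (R : realType) (X : normedLatticeType R)
    (Y : vectorLatticeType R) (j : ideal_inclusion X Y) (e : R) (x : X)
    : set Y :=
  [set z | exists2 u : X, j u = vmeet (vabs z) (j x) & `|u| < e].

Definition un_nbhs (R : realType) (X : normedLatticeType R)
    (Y : vectorLatticeType R) (j : ideal_inclusion X Y) (y : Y)
    : set_system Y :=
  [set W | exists e : R, exists x : X,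
    [/\ 0 < e, 0 <=v x & [set y + z | z in un_ball j e x] `<=` W]].

Section VectorLatticeTheory.
Context (R : realType) (V : vectorLatticeType R).
Implicit Types x y z a b c : V.

Lemma vleIl x y : vmeet x y <=v x.
Proof. by have := vle_refl (vmeet x y); rewrite vlexI => /andP[]. Qed.

Lemma vleIr x y : vmeet x y <=v y.
Proof. by have := vle_refl (vmeet x y); rewrite vlexI => /andP[]. Qed.

Lemma vleUl x y : x <=v vjoin x y.
Proof. by have := vle_refl (vjoin x y); rewrite vleUx => /andP[]. Qed.

Lemma vleUr x y : y <=v vjoin x y.
Proof. by have := vle_refl (vjoin x y); rewrite vleUx => /andP[]. Qed.

Lemma vleI2 x y z t : x <=v z -> y <=v t -> vmeet x y <=v vmeet z t.
Proof.
move=> xz yt; rewrite vlexI; apply/andP; split.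
- exact: vle_trans (vleIl _ _) xz.
- exact: vle_trans (vleIr _ _) yt.
Qed.

Lemma vleD2rE x y z : (x + z <=v y + z) = (x <=v y).
Proof.
apply/idP/idP => [h|]; last exact: vleD2r.
by have := vleD2r _ _ (- z) h; rewrite !addrK.
Qed.

Lemma vleBlDr x y z : (x - y <=v z) = (x <=v z + y).
Proof. by rewrite -(vleD2rE _ _ y) subrK. Qed.

Lemma vleD x y z t : x <=v y -> z <=v t -> x + z <=v y + t.
Proof.
move=> xy zt; apply: (@vle_trans _ _ (y + z)); first by rewrite vleD2rE.
by rewrite ![y + _]addrC vleD2rE.
Qed.

Lemma voppr_le0 x : (- x <=v 0) = (0 <=v x).
Proof. by rewrite -(vleD2rE _ _ x) addNr add0r. Qed.

Lemma vabs_ge0 x : 0 <=v vabs x.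
Proof.
have h : 0 <=v vabs x + vabs x.
  by rewrite -(subrr x); apply: vleD; rewrite /vabs ?vleUl ?vleUr.
have h2 : (0 : R) <= 2^-1 by rewrite invr_ge0 ler0n.
have := vscale_ge0 _ _ h2 h.
by rewrite -mulr2n -[vabs x *+ 2]scaler_nat scalerA mulVf ?scale1r// pnatr_eq0.
Qed.

Lemma vger0_abs x : 0 <=v x -> vabs x = x.
Proof.
move=> x0; apply: vle_anti; rewrite vleUl andbT vleUx vle_refl andTb.
by apply: (vle_trans _ _ _ _ x0); rewrite voppr_le0.
Qed.

Lemma vabsD x y : vabs (x + y) <=v vabs x + vabs y.
Proof.
rewrite {1}/vabs vleUx opprD.
by apply/andP; split; apply: vleD; rewrite /vabs ?vleUl ?vleUr.
Qed.

Lemma vmeetDl a b c : 0 <=v a -> 0 <=v b -> 0 <=v c ->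
  vmeet (a + b) c <=v vmeet a c + vmeet b c.
Proof.
move=> a0 b0 c0; set t := vmeet (a + b) c.
have tab : t <=v a + b by exact: vleIl.
have tc : t <=v c by exact: vleIr.
rewrite addrC -vleBlDr vlexI; apply/andP; split.
- rewrite vleBlDr addrC -vleBlDr vlexI !vleBlDr tab /=.
  by rewrite -[t]addr0; exact: vleD.
- rewrite vleBlDr -[t]addr0; apply: vleD => //.
  by rewrite vlexI a0.
Qed.

End VectorLatticeTheory.

Section UnTopology.
Context (R : realType) (X : normedLatticeType R) (Y : vectorLatticeType R).
Variable j : ideal_inclusion X Y.

Lemma un_ball_exists (x : X) (z : Y) : 0 <=v x ->
  exists u : X, 0 <=v u /\ j u = vmeet (vabs z) (j x).
Proof.
move=> x0; have jx0 : 0 <=v j x by rewrite -(raddf0 j) incl_le.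
have m0 : 0 <=v vmeet (vabs z) (j x) by rewrite vlexI vabs_ge0.
have [|u ju] := @incl_ideal _ _ _ j x (vmeet (vabs z) (j x)).
  by rewrite (vger0_abs m0) (vger0_abs jx0) vleIr.
by exists u; rewrite -(incl_le j) raddf0 ju.
Qed.

Lemma un_ball_le (e : R) (x u : X) (z : Y) : 0 <=v x ->
  vmeet (vabs z) (j x) <=v j u -> `|u| < e -> un_ball j e x z.
Proof.
move=> x0 zu ue; have [v [v0 jv]] := un_ball_exists z x0.
exists v => //; apply: le_lt_trans ue; apply: ler_norm_vabs.
have vu : v <=v u by rewrite -(incl_le j) jv.
by rewrite !vger0_abs// (vle_trans _ _ _ v0).
Qed.

Lemma un_ball0 (e : R) (x : X) : 0 < e -> 0 <=v x -> un_ball j e x 0.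
Proof.
move=> e0 x0; apply: (@un_ball_le _ _ 0) => //; last by rewrite normr0.
by rewrite raddf0 vger0_abs ?vle_refl ?vleIl.
Qed.

Lemma un_ballD (e : R) (x : X) (y z : Y) : 0 <=v x ->
  un_ball j (e / 2) x y -> un_ball j (e / 2) x z -> un_ball j e x (y + z).
Proof.
move=> x0 [u ju ue] [v jv ve].
have jx0 : 0 <=v j x by rewrite -(raddf0 j) incl_le.
apply: (@un_ball_le _ _ (u + v)) => //.
  have -> : j (u + v) = j u + j v by exact: raddfD.
  rewrite ju jv.
  apply: vle_trans (vmeetDl (vabs_ge0 y) (vabs_ge0 z) jx0).
  by apply: vleI2; [exact: vabsD|exact: vle_refl].
by rewrite (splitr e) (le_lt_trans (ler_normD _ _))// ltrD.
Qed.

Lemma un_nbhs_filter (y : Y) : ProperFilter (un_nbhs j y).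
Proof.
split.
  move=> [e [x [e0 x0]]]; apply.
  by exists 0 => //; exact: un_ball0.
split.
- by exists 1, 0; split; [exact: ltr01|exact: vle_refl|].
- move=> A B [e [x [e0 x0 eA]]] [f [w [f0 w0 fB]]].
  have xw0 : 0 <=v vjoin x w by rewrite (vle_trans _ _ _ x0)// vleUl.
  exists (Num.min e f), (vjoin x w); split => //.
    by rewrite lt_min e0.
  move=> _ [z [u ju + <-]]; rewrite lt_min => /andP[ue uf]; split.
  + apply: eA; exists z => //; apply: un_ball_le ue => //.
    by rewrite ju; apply: vleI2; rewrite ?vle_refl// incl_le vleUl.
  + apply: fB; exists z => //; apply: un_ball_le uf => //.
    by rewrite ju; apply: vleI2; rewrite ?vle_refl// incl_le vleUr.
- move=> A B AB [e [x [e0 x0 eA]]]; exists e, x; split => //.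
  exact: subset_trans AB.
Qed.

Lemma un_nbhs_singleton (y : Y) (A : set Y) : un_nbhs j y A -> A y.
Proof.
move=> [e [x [e0 x0]]]; apply; exists 0; last by rewrite addr0.
exact: un_ball0.
Qed.

Lemma un_nbhs_nbhs (y : Y) (A : set Y) :
  un_nbhs j y A -> un_nbhs j y ((un_nbhs j)^~ A).
Proof.
move=> [e [x [e0 x0 eA]]]; exists (e / 2), x; split => //.
  by rewrite divr_gt0.
move=> _ [z hz <-]; exists (e / 2), x; split => //; first by rewrite divr_gt0.
move=> _ [w hw <-]; apply: eA; exists (z + w); last by rewrite addrA.
exact: un_ballD.
Qed.

(* [Y] equipped with the un-topology induced by [X]. *)
Definition un_space (i : ideal_inclusion X Y) : Type := Y.

HB.instance Definition _ := Choice.on (un_space j).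
HB.instance Definition _ := hasNbhs.Build (un_space j) (un_nbhs j).
HB.instance Definition _ := Nbhs_isNbhsTopological.Build (un_space j)
  un_nbhs_filter un_nbhs_singleton un_nbhs_nbhs.

End UnTopology.

(* Main.v *)
Require Import Defs.
From mathcomp Require Import all_boot all_order all_algebra.
From mathcomp Require Import all_classical all_reals all_analysis.

(** Write [X1] and [X2] for the two ideals and [I] for their intersection.
    Since basic neighbourhoods are translates of balls around the origin, it is
    enough to find, inside each ball [{y : || |y| /\ x ||_1 < e}] of [X1], some
    ball of [X2]; the argument is then applied with the two ideals exchanged.

    Two facts are needed.  First, [I] is norm dense in [X1] from below
    ([common_part_approx]): the elements [z] of [I] with [0 <= z <= x] form an
    upward directed family whose supremum is [x], because order density would
    otherwise fit a nonzero element of [I], hence all of its multiples, below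
    [x], against the Archimedean property.  By order continuity
    [||x - z||_1] is small for some such [z], and since
    [|y| /\ x <= |y| /\ z + (x - z)] the centre [x] may be replaced by [z].

    Secondly, once [z] lies in both ideals, the two norms define the same null
    sequences in the order interval [[0, z]] ([norm_small_on_interval]).  If
    [u n] lies in [[0, z]] and [||u n||_2 <= 2^-n], the tails [s n] of the
    series of the [u n], which exist as [X2] is complete, decrease, dominate
    [u n] and tend to [0] in norm.  So [s n /\ z] decreases to [0] in [X2].
    This is a purely order-theoretic fact about elements below [z], thus it also
    holds in [X1], whose order continuity gives [||u n||_1 -> 0].  Hence the
    ball of [X2] centred at [z] with a small radius is contained in the given
    ball of [X1]. *)

Set Implicit Arguments.
Unset Strict Implicit.
Unset Printing Implicit Defensive.

Import Order.TTheory GRing.Theory Num.Theory.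
Import numFieldNormedType.Exports.

Local Open Scope classical_set_scope.
Local Open Scope ring_scope.

(** * Norm and order in a normed lattice *)

Lemma vsubr_ge0 (R : realType) (V : vectorLatticeType R) (x y : V) :
  (0 <=v y - x) = (x <=v y).
Proof. by rewrite -(vleD2rE _ _ x) add0r subrK. Qed.

Lemma vleB2l (R : realType) (V : vectorLatticeType R) (x y z : V) :
  x <=v y -> z - y <=v z - x.
Proof.
move=> xy; rewrite -vsubr_ge0 opprB [X in _ <=v X]addrC addrA subrK.
by rewrite vsubr_ge0.
Qed.

Lemma ler_norm_ge0 (R : realType) (X : normedLatticeType R) (x y : X) :
  0 <=v x -> x <=v y -> `|x| <= `|y|.
Proof.
move=> x0 xy; apply: ler_norm_vabs.
by rewrite !vger0_abs// (vle_trans _ _ _ x0).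
Qed.

(** The positive part of [x] is below [|w|] for every [w] above [x], so its norm
    is zero; this is the closedness of the positive cone. *)
Lemma vle0_norm_small (R : realType) (X : normedLatticeType R) (x : X) :
  (forall e : R, 0 < e -> exists2 w : X, x <=v w & `|w| < e) -> x <=v 0.
Proof.
move=> small; have p0 : 0 <=v vjoin x 0 := vleUr _ _.
suff p_eq0 : `|vjoin x 0| <= 0.
  by move: p_eq0; rewrite normr_le0 => /eqP <-; exact: vleUl.
apply/ler_addgt0Pl => e e0; rewrite addr0.
have [w xw we] := small e e0; apply: le_trans (ltW we).
apply: ler_norm_vabs; rewrite (vger0_abs p0) vleUx vabs_ge0 andbT.
exact: vle_trans xw (vleUl _ _).
Qed.

Lemma order_continuous_small (R : realType) (X : normedLatticeType R)
    (I : Type) (le : I -> I -> Prop) (x : I -> X) (e : R) :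
  order_continuous X -> directed_preorder le -> net_decreases_to0 le x ->
  0 < e -> exists i, `|x i| < e.
Proof.
move=> oc dir dec e0; have := oc _ _ _ dir dec => /(_ _ (nbhsx_ballx 0 e e0)).
move=> [i /(_ i)] H; exists i.
have refl : le i i by case: dir.
by move: (H refl); rewrite /= /ball/= sub0r normrN normr_id.
Qed.

(** The terms [s n] are the tails of the absolutely convergent series of the
    [u n].  They bound [u n] because the partial sums increase and hence stay
    below their limit. *)
Lemma tails_dominate (R : realType) (X : banachLatticeType R) (u : nat -> X) :
  (forall n, 0 <=v u n) -> (forall n, `|u n| <= 2^-1 ^+ n) ->
  exists s : nat -> X,
    [/\ forall n, u n <=v s n,
        forall m n, (m <= n)%N -> s n <=v s m
      & forall e : R, 0 < e -> exists n, `|s n| < e].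
Proof.
move=> u0 u_le.
have cvgS : cvgn (series u).
  apply: normed_cvg.
  apply: (@series_le_cvg _ _ (geometric 1 2^-1)) => [n|n|n|] //=.
  - by rewrite mul1r; exact: u_le.
  - by apply: is_cvg_geometric_series; rewrite ger0_norm// invf_lt1// ltr1n.
set l := limn (series u).
have S_mono m n : (m <= n)%N -> series u m <=v series u n.
  move=> /subnK <-; elim: (n - m)%N => [|k IH]; first exact: vle_refl.
  apply: vle_trans IH _; rewrite addSn seriesSr -[X in X <=v _]addr0.
  by apply: vleD; [exact: vle_refl|exact: u0].
have Sl e : 0 < e -> exists N, forall n, (N <= n)%N -> `|l - series u n| < e.
  move=> e0; have /cvgrPdist_lt/(_ e e0) [N _ hN] := cvgS.
  by exists N => n Nn; exact: hN.
have S_le n : series u n <=v l.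
  rewrite -(vleD2rE _ _ (- l)) subrr.
  apply: vle0_norm_small => e /Sl[N hN].
  exists (series u (maxn n N) - l).
    by rewrite vleD2rE; apply: S_mono; exact: leq_maxl.
  by rewrite distrC; apply: hN; exact: leq_maxr.
exists (fun n => l - series u n); split => [n|m n mn|e /Sl[N hN]].
- rewrite -[X in X <=v _](_ : series u n.+1 - series u n = _).
    by rewrite vleD2rE.
  exact: seriesSB.
- exact: vleB2l (S_mono _ _ mn).
- by exists N; exact: hN.
Qed.

(** * Ideals sharing an order interval *)

Section Inclusion.
Context (R : realType) (X Y : vectorLatticeType R) (j : ideal_inclusion X Y).

Lemma inclD : {morph j : x y / x + y}. Proof. exact: raddfD. Qed.
Lemma inclB : {morph j : x y / x - y}. Proof. exact: raddfB. Qed.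

Lemma incl_ge0 (x : X) : (0 <=v j x) = (0 <=v x).
Proof. by rewrite -(raddf0 j) incl_le. Qed.

Lemma incl_down (x : X) (y : Y) :
  0 <=v y -> y <=v j x -> exists2 u : X, 0 <=v u & j u = y.
Proof.
move=> y0 yx; have [|u ju] := @incl_ideal _ _ _ j x y.
  by rewrite !vger0_abs// (vle_trans _ _ _ y0).
by exists u; rewrite // -incl_ge0 ju.
Qed.

End Inclusion.

Section TwoIdeals.
Context (R : realType) (Y : vectorLatticeType R).

(** If no radius worked, there would be [u n] in [[0, z]] with
    [||u n||_2 <= 2^-n] and [||u n||_1 >= e]; the tails of their series, cut off
    at [z], decrease to [0] in both ideals. *)
Lemma norm_small_on_interval (X1 : normedLatticeType R)
    (X2 : banachLatticeType R)
    (j1 : ideal_inclusion X1 Y) (j2 : ideal_inclusion X2 Y)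
    (z1 : X1) (z2 : X2) (e : R) :
  order_continuous X1 -> 0 <=v z1 -> j1 z1 = j2 z2 -> 0 < e ->
  exists2 d : R, 0 < d & forall (a : X1) (b : X2),
    j1 a = j2 b -> 0 <=v a -> a <=v z1 -> `|b| < d -> `|a| < e.
Proof.
move=> oc z10 z12 e0; apply: contrapT => nod.
have bad n : exists ab : X1 * X2,
    [/\ j1 ab.1 = j2 ab.2, 0 <=v ab.1, ab.1 <=v z1,
        `|ab.2| <= 2^-1 ^+ n & e <= `|ab.1|].
  apply: contrapT => none; apply: nod; exists (2^-1 ^+ n) => [|a b ab a0 az bn].
    by rewrite exprn_gt0.
  rewrite ltNge; apply/negP => ea; apply: none.
  by exists (a, b); split => //; exact: ltW.
have {bad nod} [f fP] := choice bad.
have z20 : 0 <=v z2 by rewrite -(incl_ge0 j2) -z12 incl_ge0.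
have u0 n : 0 <=v (f n).2.
  by have [h h0 _ _ _] := fP n; rewrite -(incl_ge0 j2) -h incl_ge0.
have u_le n : `|(f n).2| <= 2^-1 ^+ n by have [] := fP n.
have [s [us s_mono s_small]] := tails_dominate u0 u_le.
have v0 n : 0 <=v vmeet (s n) z2 by rewrite vlexI z20 (vle_trans _ _ _ (u0 n)).
have vw n : exists w : X1, j1 w = j2 (vmeet (s n) z2).
  have [| |w _ jw] := @incl_down _ _ _ j1 z1 (j2 (vmeet (s n) z2)).
  - by rewrite incl_ge0.
  - by rewrite z12 incl_le vleIr.
  - by exists w.
have {vw} [w wP] := choice vw.
have w0 n : 0 <=v w n by rewrite -(incl_ge0 j1) wP incl_ge0.
have dir : directed_preorder (fun m n : nat => (m <= n)%N).
  split => [|//|i j k|m n]; [by split; exact: 0%N|exact: leq_trans|].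
  by exists (maxn m n); rewrite leq_maxl leq_maxr.
have dec : net_decreases_to0 (fun m n : nat => (m <= n)%N) w.
  split => // [m n mn|y yw].
    rewrite -(incl_le j1) !wP incl_le.
    by apply: vleI2; [exact: s_mono|exact: vle_refl].
  have pw n : vjoin y 0 <=v w n by rewrite vleUx yw w0.
  have p0 : 0 <=v j1 (vjoin y 0) by rewrite incl_ge0 vleUr.
  (* A positive lower bound taken in [X1] lies below [z], hence also in [X2]. *)
  have [|q q0 jq] := @incl_down _ _ _ j2 z2 _ p0.
    rewrite -z12 incl_le; apply: vle_trans (pw 0) _.
    by rewrite -(incl_le j1) wP z12 incl_le vleIr.
  have : q <=v 0.
    apply: vle0_norm_small => d /s_small[n sn]; exists (s n) => //.
    apply: vle_trans (vleIl _ z2).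
    by rewrite -(incl_le j2) jq -wP incl_le.
  rewrite -(incl_le j2) jq raddf0 -(raddf0 j1) incl_le.
  exact: vle_trans (vleUl _ _).
have [n wn] := order_continuous_small oc dir dec e0.
have [fE a0 az _] := fP n; rewrite leNgt => /negP; apply.
apply: le_lt_trans wn; apply: ler_norm_ge0 => //.
rewrite -(incl_le j1) wP fE incl_le vlexI us.
by rewrite -(incl_le j2) -fE -z12 incl_le.
Qed.

(** The positive part [p] of a lower bound of all [x - z] is again one.  If it
    were nonzero it would dominate some [c > 0] lying in both ideals, and then [c *+ n <= x] forces [c *+ n.+1 <= x],
    since [c <= p <= x - c *+ n]. *)
Lemma common_part_approx (X1 : normedLatticeType R) (X2 : vectorLatticeType R)
    (j1 : ideal_inclusion X1 Y) (j2 : ideal_inclusion X2 Y) (x : X1) (e : R) :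
  vl_archimedean Y -> order_continuous X1 -> order_dense j2 ->
  0 <=v x -> 0 < e ->
  exists z1 : X1, exists z2 : X2,
    [/\ 0 <=v z1, z1 <=v x, j1 z1 = j2 z2 & `|x - z1| < e].
Proof.
move=> arch oc dense x0 e0.
pose common z := [/\ 0 <=v z, z <=v x & exists z2 : X2, j1 z = j2 z2].
pose I := {z : X1 | common z}.
have common0 : common 0.
  by split; rewrite ?vle_refl//; exists 0; rewrite !raddf0.
pose le (z t : I) : Prop := sval z <=v sval t.
have dir : directed_preorder le.
  split; first by split; exists 0.
  - by move=> i; exact: vle_refl.
  - by move=> i j k; exact: vle_trans.
  move=> [z [z0 zx [z2 zz2]]] [t [t0 tx [t2 tt2]]].
  have zt0 : 0 <=v vjoin z t by apply: vle_trans z0 (vleUl _ _).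
  suff zt : common (vjoin z t).
    by exists (exist _ _ zt); rewrite /le/= vleUl vleUr.
  split=> //; first by rewrite vleUx zx.
  have [| |u _ ju] := @incl_down _ _ _ j2 (z2 + t2) (j1 (vjoin z t)).
  - by rewrite incl_ge0.
  - rewrite inclD -zz2 -tt2 -inclD incl_le vleUx.
    rewrite -[X in (X <=v _) && _]addr0 -[X in _ && (X <=v _)]add0r.
    by apply/andP; split; apply: vleD; rewrite ?vle_refl.
  by exists u.
have dec : net_decreases_to0 le (fun z : I => x - sval z).
  split => [i j ij|z|b bx].
  - exact: vleB2l.
  - by rewrite vsubr_ge0; case: (svalP z).
  have px (z : X1) : common z -> vjoin b 0 <=v x - z.
    by move=> cz; rewrite vleUx (bx (exist _ z cz)) /= vsubr_ge0; case: cz.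
  have [<-|pN0] := eqVneq (vjoin b 0) 0; first exact: vleUl.
  have [|c2 [/andP[c2N0 c20] c2p]] := dense (j1 (vjoin b 0)).
    rewrite incl_ge0 vleUr andbT; apply/negP => /eqP p0; move/negP: pN0; apply.
    by apply/eqP/vle_anti; rewrite -!(incl_le j1) -p0 raddf0 vle_refl.
  have [c c0 jc] := incl_down c20 c2p.
  have cp : c <=v vjoin b 0 by rewrite -(incl_le j1) jc.
  have c_common n : common (c *+ n).
    elim: n => [|n IH]; first by rewrite mulr0n.
    have := px _ IH; case: IH => cn0 cnx [t jt] pcn; split.
    + rewrite mulrS -[X in X <=v _](addr0 0).
      by apply: vleD.
    + have := vle_trans _ _ _ cp pcn.
      by rewrite -(vleD2rE _ _ (c *+ n)) subrK -mulrS.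
    + by exists (c2 + t); rewrite mulrS !inclD jc jt.
  case/negP: c2N0; rewrite eq_sym; apply/eqP.
  apply: (arch _ (j1 x)) => // n.
  by rewrite -jc -raddfMn incl_le; case: (c_common n).
have [[z [z0 zx [z2 zz2]]] /= xz] := order_continuous_small oc dir dec e0.
by exists z, z2; split.
Qed.

(** * Comparison of the two un-topologies *)

(** Half of [e] pays for replacing [x] by a [z <= x] lying in both ideals, the
    other half for passing from one norm to the other on [[0, z]]. *)
Lemma un_ball_refine (X1 X2 : banachLatticeType R)
    (j1 : ideal_inclusion X1 Y) (j2 : ideal_inclusion X2 Y) (x : X1) (e : R) :
  vl_archimedean Y -> order_continuous X1 -> order_dense j2 ->
  0 <=v x -> 0 < e ->
  exists d : R, exists z : X2,
    [/\ 0 < d, 0 <=v z & un_ball j2 d z `<=` un_ball j1 e x].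
Proof.
move=> arch oc dense x0 e0; have e20 : 0 < e / 2 by rewrite divr_gt0.
have [z1 [z2 [z10 z1x z12 xz]]] := common_part_approx j1 arch oc dense x0 e20.
have [d d0 hd] := norm_small_on_interval oc z10 z12 e20.
have z20 : 0 <=v z2 by rewrite -(incl_ge0 j2) -z12 incl_ge0.
exists d, z2; split => // y [b jb bd].
have [a [a0 ja]] := un_ball_exists j1 y z10.
have ab : j1 a = j2 b by rewrite ja jb z12.
have ae : `|a| < e / 2.
  by apply: (hd a b) => //; rewrite -(incl_le j1) ja vleIr.
apply: (@un_ball_le _ _ _ _ _ _ (a + (x - z1))) => //; last first.
  by rewrite (splitr e) (le_lt_trans (ler_normD _ _))// ltrD.
rewrite inclD ja -vleBlDr vlexI !vleBlDr inclB; apply/andP; split.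
- rewrite -[X in X <=v _]addr0; apply: vleD; first exact: vleIl.
  by rewrite -inclB incl_ge0 vsubr_ge0.
- by rewrite addrC subrK vleIr.
Qed.

Lemma un_open_sub (X1 X2 : banachLatticeType R)
    (j1 : ideal_inclusion X1 Y) (j2 : ideal_inclusion X2 Y) (W : set Y) :
  vl_archimedean Y -> order_continuous X1 -> order_dense j2 ->
  @open (un_space j1) W -> @open (un_space j2) W.
Proof.
move=> arch oc dense; rewrite !openE => Wo y Wy.
have [e [x [e0 x0 xW]]] : un_nbhs j1 y W := Wo y Wy.
have [d [z [d0 z0 zx]]] := un_ball_refine j1 arch oc dense x0 e0.
suff : un_nbhs j2 y W by [].
exists d, z; split => // _ [t zt <-].
by apply: xW; exists t => //; exact: zx.
Qed.

End TwoIdeals.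

Theorem theorem2p6 (R : realType) (Y : vectorLatticeType R)
    (X1 X2 : banachLatticeType R)
    (j1 : ideal_inclusion X1 Y) (j2 : ideal_inclusion X2 Y) :
  vl_archimedean Y ->
  order_continuous X1 -> order_continuous X2 ->
  order_dense j1 -> order_dense j2 ->
  forall W : set Y, @open (un_space j1) W <-> @open (un_space j2) W.
Proof. by move=> arch oc1 oc2 d1 d2 W; split; exact: un_open_sub. Qed.
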